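(* Let $X$ be a non-empty subshift such that $(X,\sigma)$ is transitive, where $\sigma$ is the shift map, and let $(X,T)$ be a cellular automaton. Then $(X,T)$ is almost equicontinuous if and only if it is not sensitive.
   Context: Let $A$ be a finite alphabet with at least two elements. The full shift $A^{\mathbb Z}$ carries the metric $d(x,y)=2^{-i}$ with $i=\min\{|j|: x_j\neq y_j\}$ if $x\neq y$, and $d(x,x)=0$. The shift map is $\sigma(x)_i=x_{i+1}$. A subshift is a closed $\sigma$-invariant set $X\subseteq A^{\mathbb Z}$. A topological dynamical system (TDS) is a pair $(X,T)$ with $X$ a compact metric space and $T:X\to X$ continuous. A cellular automaton (CA) is a pair $(X,T)$ where $X$ is a subshift and $T:X\to X$ is continuous with $\sigma\circ T=T\circ\sigma$. A TDS $(X,T)$ is transitive if for every pair of non-empty open sets $U,V\subseteq X$ there is $n>0$ with $T^{-n}U\cap V\neq\emptyset$. A point $x\in X$ is an equicontinuity point if for every $\varepsilon>0$ there is $\delta>0$ such that for all $y\in B_\delta(x)$ and all $n\ge 0$, $d(T^nx,T^ny)<\varepsilon$. $EQ$ denotes the set of equicontinuity points. A set is residual if it is the intersection of countably many dense open sets. $(X,T)$ is almost equicontinuous if $EQ$ is residual. $(X,T)$ is sensitive if there is $\varepsilon>0$ such that for every non-empty open $U\subseteq X$ there exist $x,y\in U$ and $n>0$ with $d(T^nx,T^ny)>\varepsilon$. *)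

(* Defs.v *)
From HB Require Import structures.
From mathcomp Require Import all_boot all_order all_algebra.
From mathcomp Require Import all_classical all_reals all_analysis.
From mathcomp Require Import borel_hierarchy.

Set Implicit Arguments.
Unset Strict Implicit.
Unset Printing Implicit Defensive.

Import Order.TTheory GRing.Theory Num.Theory.

Local Open Scope classical_set_scope.
Local Open Scope ring_scope.

Section Dynamics.
Context {R : realType} {M : metricType R}.
Implicit Type T : M -> M.

Definition transitive_map T := forall U V : set M,
  open U -> open V -> U !=set0 -> V !=set0 ->
  exists2 n, (0 < n)%N & (iter n T @^-1` U) `&` V !=set0.

Definition equicontinuity_point T (x : M) := forall eps : R, 0 < eps ->
  exists2 delta : R, 0 < delta & forall y, ball x delta y ->
    forall n, mdist (iter n T x) (iter n T y) < eps.

Definition EQ T : set M := [set x | equicontinuity_point T x].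

(* [Gdelta_dense] is an intersection of countably many dense open sets,
   not merely a superset of one. *)
Definition almost_equicontinuous T := Gdelta_dense (EQ T).

Definition sensitive T := exists2 eps : R, 0 < eps &
  forall U : set M, open U -> U !=set0 ->
    exists x y n, [/\ U x, U y, (0 < n)%N &
                      eps < mdist (iter n T x) (iter n T y)].

End Dynamics.

(* [R] is a phantom parameter: the metric takes its values in [R], and HB needs
   to recover [R] from the carrier. The alias also hides the product structures
   that MathComp-Analysis puts on function types. *)
Definition full_shift (R : realType) (A : finType) : Type := int -> A.

Section FullShift.
Context {R : realType} {A : finType}.
Local Notation S := (full_shift R A).
Implicit Types x y z : S.

HB.instance Definition _ := gen_eqMixin S.
HB.instance Definition _ := gen_choiceMixin S.

Definition differ_at x y : pred nat :=
  fun i => `[< exists2 j : int, `|j|%N = i & x j <> y j >].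

Lemma differ_at_ex x y : x <> y -> exists i, differ_at x y i.
Proof.
move=> xy; apply: contrapT => nxy; apply: xy; apply/funext => j.
apply: contrapT => xyj; apply: nxy; exists `|j|%N; apply/asboolP.
by exists j.
Qed.

Definition shift_dist x y : R :=
  match pselect (x <> y) with
  | left xy => 2 ^- ex_minn (differ_at_ex xy)
  | right _ => 0
  end.

Lemma shift_distxx x : shift_dist x x = 0.
Proof. by rewrite /shift_dist; case: pselect. Qed.

Lemma shift_dist_ge0 x y : 0 <= shift_dist x y.
Proof.
by rewrite /shift_dist; case: pselect => // xy; rewrite invr_ge0 exprn_ge0.
Qed.

Lemma shift_dist_positivity x y : shift_dist x y = 0 -> x = y.
Proof.
rewrite /shift_dist; case: pselect => [xy /eqP|/contrapT//].
by rewrite invr_eq0 expf_eq0 pnatr_eq0 andbF.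
Qed.

Lemma shift_dist_sym x y : shift_dist x y = shift_dist y x.
Proof.
rewrite /shift_dist; case: pselect => xy; case: pselect => yx //; last first.
- by case: xy => /esym.
- by case: yx => /esym.
have differ_sym u v i : differ_at u v i -> differ_at v u i.
  by move=> /asboolP[j ji uv]; apply/asboolP; exists j => // /esym.
case: ex_minnP => m xym minm; case: ex_minnP => k yxk mink.
congr (2 ^- _); apply/eqP; rewrite eqn_leq.
by rewrite minm ?mink//; exact: differ_sym.
Qed.

Lemma shift_dist_geP x y (j : int) :
  x j <> y j -> 2 ^- `|j|%N <= shift_dist x y.
Proof.
move=> xyj; rewrite /shift_dist; case: pselect => [xy|]; last first.
  by move=> /contrapT xy; rewrite xy in xyj.
case: ex_minnP => m _ minm; rewrite lef_pV2 ?posrE ?exprn_gt0//.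
rewrite ler_eXn2l ?ltr1n//; apply: minm.
by apply/asboolP; exists j.
Qed.

Lemma shift_dist_triangle y x z :
  shift_dist x z <= shift_dist x y + shift_dist y z.
Proof.
rewrite {1}/shift_dist; case: pselect => [xz|_]; last first.
  by rewrite addr_ge0 ?shift_dist_ge0.
case: ex_minnP => m /asboolP[j <- xzj] _.
have [xyj|xyj] := pselect (x j = y j).
  by rewrite ler_wpDl ?shift_dist_ge0// shift_dist_geP// -xyj.
by rewrite ler_wpDr ?shift_dist_ge0// shift_dist_geP.
Qed.

HB.instance Definition _ := isMetric.Build R S shift_distxx
  shift_dist_positivity shift_dist_sym shift_dist_triangle.

Definition shift x : S := fun i => x (i + 1).

End FullShift.

Section SubspaceMetric.
Context {R : realType} {M : metricType R} (X : set M).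

Let sub_dist (x y : X) : R := mdist (val x) (val y).

Let sub_dist_ge0 x y : 0 <= sub_dist x y.
Proof. exact: mdist_ge0. Qed.

Let sub_dist_positivity x y : sub_dist x y = 0 -> x = y.
Proof. by move=> /mdist_positivity/val_inj. Qed.

Let ball_sub_dist x e : ball x e = [set y | sub_dist x y < e].
Proof. by rewrite -initial_ballE ballEmdist set_valE. Qed.

HB.instance Definition _ := PseudoMetric_isMetric.Build R (set_type X)
  sub_dist_ge0 sub_dist_positivity ball_sub_dist.

End SubspaceMetric.

(* Invariance is the inclusion of [shift @` X] in [X], which is what is needed
   for the shift to act on [X]. *)
Record subshift (R : realType) (A : finType) := Subshift {
  subshift_set :> set (full_shift R A);
  subshift_closed : closed subshift_set;
  subshift_invariant : forall x, subshift_set x -> subshift_set (shift x) }.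

Section CellularAutomata.
Context {R : realType} {A : finType} (X : subshift R A).

Definition subshift_map (x : X) : X :=
  exist _ (shift (val x))
    (mem_set (subshift_invariant (set_mem (valP x)))).

Definition cellular_automaton (T : X -> X) :=
  continuous T /\ subshift_map \o T =1 T \o subshift_map.

End CellularAutomata.

Arguments subshift_map {R A} X x.

(* Main.v *)
(* An equicontinuity point excludes sensitivity, and a dense G_delta of the
   subshift contains a point by Baire. Conversely, let r be the radius of the
   local rule of T. If T is not sensitive, some cylinder U is such that the
   orbits of its points agree on [-r, r] at all positive times. By transitivity
   every open set contains a point x with shift^-a x and shift^b x in U, for a
   and b arbitrarily large; the two occurrences block the propagation of
   differences, so the orbit of x on [-a, b] depends only on finitely many
   coordinates of x. The points whose orbit on [-m, m] is so determined thus
   form a dense open set, and EQ is the intersection of these sets over m. *)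
Require Import Defs.
From mathcomp Require Import all_boot all_order all_algebra.
From mathcomp Require Import all_classical all_reals all_analysis.
From mathcomp Require Import borel_hierarchy.
From mathcomp Require Import zify.

Set Implicit Arguments.
Unset Strict Implicit.
Unset Printing Implicit Defensive.

Import Order.TTheory GRing.Theory Num.Theory.

Local Open Scope classical_set_scope.
Local Open Scope ring_scope.

(** * Agreement on central windows and the metric *)

Definition agree (A : Type) (n : nat) (x y : int -> A) :=
  forall j : int, (`|j| <= n)%N -> x j = y j.

Section Agree.
Context {A : Type}.
Implicit Types x y z : int -> A.

Lemma agree_refl n x : agree n x x. Proof. by []. Qed.

Lemma agree_sym n x y : agree n x y -> agree n y x.
Proof. by move=> xy j jn; rewrite xy. Qed.

Lemma agree_trans n y x z : agree n x y -> agree n y z -> agree n x z.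
Proof. by move=> xy yz j jn; rewrite xy// yz. Qed.

Lemma agree_leq m n x y : (m <= n)%N -> agree n x y -> agree m x y.
Proof. by move=> mn xy j jm; apply: xy; exact: leq_trans mn. Qed.

Lemma agree_shift n a x y : agree (n + a) x y ->
  agree n (fun j => x (j + a%:Z)) (fun j => y (j + a%:Z)).
Proof. by move=> xy j jn; apply: xy; lia. Qed.

End Agree.

Section FullShift.
Context {R : realType} {A : finType}.
Implicit Types x y : full_shift R A.

Lemma mdist_agree n x y : mdist x y < 2 ^- n <-> agree n x y.
Proof.
split=> [xy j jn|xy].
  apply: contrapT => /(shift_dist_geP (R := R)) xyj.
  move: xy; apply/negP; rewrite -leNgt; apply: le_trans xyj.
  by rewrite lef_pV2 ?posrE ?exprn_gt0// ler_eXn2l ?ltr1n.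
rewrite /mdist/= /shift_dist; case: pselect => [ne|_]; last first.
  by rewrite invr_gt0 exprn_gt0.
case: ex_minnP => m /asboolP[j jm xyj] _.
rewrite ltf_pV2 ?posrE ?exprn_gt0// ltr_eXn2l ?ltr1n//.
by rewrite ltnNge; apply/negP => mn; apply: xyj; apply: xy; rewrite jm.
Qed.

Lemma expr2V_small (e : R) : 0 < e -> exists n : nat, 2 ^- n < e.
Proof.
move=> e0; have [N _ H] := near_infty_natSinv_expn_lt (PosNum e0).
by exists N; rewrite -div1r; apply: H => /=.
Qed.

Lemma iter_shift k x : iter k (@Defs.shift R A) x = fun j => x (j + k%:Z).
Proof.
elim: k => [|k IH]; first by apply/funext => j; rewrite addr0.
rewrite iterS IH; apply/funext => j; rewrite /Defs.shift; congr (x _); lia.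
Qed.

End FullShift.

(** * Cylinders, Baire property and compactness of a subshift *)

Section Subshift.
Context {R : realType} {A : finType} (X : subshift R A).
Implicit Types (x y z : X) (U V : set X) (T : X -> X).
Local Notation sigma := (subshift_map X).

Lemma sub_mdist_agree n x y : mdist x y < 2 ^- n <-> agree n (val x) (val y).
Proof. exact: mdist_agree. Qed.

Lemma nbhs_agreeP x U :
  nbhs x U <-> exists n, forall y, agree n (val x) (val y) -> U y.
Proof.
split=> [/nbhs_ballP[e /= e0 xU]|[n xU]]; last apply/nbhs_ballP.
  have [n ne] := expr2V_small e0; exists n => y /sub_mdist_agree xy.
  by apply: xU; rewrite ballEmdist/=; exact: lt_trans ne.
exists (2 ^- n) => /=; first by rewrite invr_gt0 exprn_gt0.
by move=> y; rewrite ballEmdist/= => /sub_mdist_agree; exact: xU.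
Qed.

Definition cyl x n : set X := [set y | agree n (val x) (val y)].

Lemma open_cyl x n : open (cyl x n).
Proof.
rewrite openE => y xy; apply/nbhs_agreeP; exists n => z.
exact: agree_trans.
Qed.

Lemma cyl_neq0 x n : cyl x n !=set0.
Proof. by exists x; exact: agree_refl. Qed.

Lemma open_cylP U : open U -> forall x, U x -> exists n, cyl x n `<=` U.
Proof. by rewrite openE => oU x /oU /nbhs_agreeP. Qed.

(** Closedness in the form that puts sequences built coordinate by coordinate into [X]. *)
Lemma subshift_limit (x : full_shift R A) :
  (forall n, exists y : X, agree n x (val y)) -> subshift_set X x.
Proof.
move=> xX; have [+ _] := closure_id (subshift_set X).
move=> ->; last exact: subshift_closed.
move=> B /nbhs_ballP[e /= e0 xB].
have [n ne] := expr2V_small e0; have [y /mdist_agree xy] := xX n.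
exists (val y); split; first exact: set_mem (valP y).
by apply: xB; rewrite ballEmdist/=; exact: lt_trans ne.
Qed.

Lemma val_iter_sigma k x : val (iter k sigma x) = fun j => val x (j + k%:Z).
Proof.
rewrite -(iter_shift (R := R)).
by elim: k => //= k IH; rewrite -IH.
Qed.

(** Nested cylinders of strictly growing radius are chosen, each inside the next [F k]; their
    centres stabilise at every coordinate. *)
Lemma subshift_baire (F : (set X)^nat) : [set: X] !=set0 ->
  (forall i, open (F i) /\ dense (F i)) -> \bigcap_i F i !=set0.
Proof.
move=> [x0 _] oF.
have step (ks : nat * (X * nat)) : exists s : X * nat,
    [/\ (ks.2.2 < s.2)%N, agree ks.2.2 (val ks.2.1) (val s.1) &
        cyl s.1 s.2 `<=` F ks.1].
  case: ks => k [x n] /=; have [oFk dFk] := oF k.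
  have [y [xy Fy]] : cyl x n `&` F k !=set0.
    by apply: dFk; [exact: cyl_neq0|exact: open_cyl].
  have [m yF] := open_cylP oFk Fy.
  exists (y, maxn m n.+1); split => //=; first by rewrite leq_maxr.
  by move=> z /(agree_leq (leq_maxl _ _)); exact: yF.
have [f fP] := choice step.
pose s := fix s k := if k is k'.+1 then f (k', s k') else (x0, 0%N).
have sP k := fP (k, s k).
have s_ge k : (k <= (s k).2)%N.
  elim: k => //= k IH; have [+ _ _] := sP k; exact: leq_ltn_trans.
have s_agree k i : agree (s k).2 (val (s k).1) (val (s (i + k)).1).
  have s_mono i' : ((s k).2 <= (s (i' + k)).2)%N.
    elim: i' => // i' IH; have [lt _ _] := sP (i' + k)%N.
    by rewrite (leq_trans IH)// ltnW.
  elim: i => // i IH; apply: agree_trans IH _; have [_ + _] := sP (i + k)%N.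
  exact: agree_leq (s_mono i).
(* Stage [|j|] has radius at least [|j|], so coordinate [j] no longer changes from there on. *)
pose x : full_shift R A := fun j => val (s `|j|%N).1 j.
have sx k : agree (s k).2 (val (s k).1) x.
  move=> j jk; have [kj|/ltnW jk'] := leqP k `|j|%N.
    by rewrite /x -(subnK kj); exact: s_agree.
  by rewrite /x -[in LHS](subnK jk') -(s_agree `|j|%N)// s_ge.
have Xx : subshift_set X x.
  apply: subshift_limit => n; exists (s n).1; apply: agree_sym.
  by apply: agree_leq (sx n); exact: s_ge.
exists (exist _ x (mem_set Xx)) => k _; have [_ _ +] := sP k; apply.
exact: (sx k.+1).
Qed.

(** Compactness: at each coordinate the ultrafilter selects one letter of the finite alphabet, and
    these letters form the limit. *)
Lemma ultra_cvg_subshift (I : Type) (G : set_system I) (u : I -> X) :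
  UltraFilter G -> exists x : X, u @ G --> x.
Proof.
move=> UG; have PG : ProperFilter G by exact: ultra_proper.
have coord (j : int) : exists a : A, G [set i | a = val (u i) j].
  apply: contrapT => /forallNP Ga.
  have : G [set i | forall a : A, ~ (a = val (u i) j)].
    apply: filter_forall => a.
    by have [/Ga|] := in_ultra_setVsetC [set i | a = val (u i) j] UG.
  by move=> /filter_ex[i] /(_ (val (u i) j)).
have [x xP] := choice coord.
have xG n : G [set i | agree n x (val (u i))].
  elim: n => [|n IH].
    by apply: filterS (xP 0) => i xi j; rewrite leqn0 absz_eq0 => /eqP ->.
  apply: filterS (filterI IH (filterI (xP n.+1%:Z) (xP (- n.+1%:Z)))).
  move=> i [xi [xp xn]] j jn.
  have [|] := leqP `|j|%N n; first exact: xi.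
  move=> nj; have [->//|->//] : j = n.+1%:Z \/ j = - n.+1%:Z by lia.
have Xx : subshift_set X x.
  by apply: subshift_limit => n; have /filter_ex[i xi] := xG n; exists (u i).
exists (exist _ x (mem_set Xx)) => U /nbhs_agreeP[n xU].
by apply: filterS (xG n) => i; exact: xU.
Qed.

(* Curtis-Hedlund-Lyndon *)
Lemma local_rule0 T : continuous T -> exists r, forall x y,
  agree r (val x) (val y) -> val (T x) 0 = val (T y) 0.
Proof.
move=> cT; apply: contrapT => /forallNP nr.
have bad r : exists xy : X * X, agree r (val xy.1) (val xy.2) /\
    val (T xy.1) 0 <> val (T xy.2) 0.
  have /existsNP[x /existsNP[y /not_implyP ?]] := nr r.
  by exists (x, y).
have [w wP] := choice bad.
(* Along [G] both components of the bad pairs tend to one point [x], where continuity of [T] forces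
   equal letters at 0. *)
have [G [UG ooG]] := ultraFilterLemma eventually_filter.
have PG : ProperFilter G by exact: ultra_proper.
have [x ux] := ultra_cvg_subshift (fst \o w) UG.
have vx : (snd \o w) @ G --> x.
  move=> U /nbhs_agreeP[n xU].
  have Gn : G [set i | cyl x n (w i).1].
    by apply: (ux (cyl x n)); apply/nbhs_agreeP; exists n.
  have Gn' : G [set i | (n <= i)%N] by apply: ooG; exists n.
  change (G [set i | U (w i).2]).
  apply: filterS (filterI Gn Gn') => i [xi ni]; apply: xU.
  by apply: agree_trans xi _; apply: (agree_leq ni); case: (wP i).
pose S := [set y | val (T x) 0 = val (T y) 0].
have T0 : nbhs x S.
  apply: (cT x [set z | val (T x) 0 = val z 0]); apply/nbhs_agreeP.
  by exists 0%N => y; exact.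
have Su : G [set i | S (w i).1] by exact: (ux S).
have Sv : G [set i | S (w i).2] by exact: (vx S).
have [i [/= Tu Tv]] := filter_ex (filterI Su Sv).
by case: (wP i) => _; apply; rewrite -Tu.
Qed.

(** * Cellular automata over a transitive shift *)

Section Transitive.
Hypothesis sigma_trans : transitive_map sigma.

(** By transitivity some orbit enters any cylinder around [y] after at least one step; the point one
    step earlier approximates the preimage. *)
Lemma sigma_surj y : exists x, sigma x = y.
Proof.
pose x : full_shift R A := fun j => val y (j - 1).
have Xx : subshift_set X x.
  apply: subshift_limit => n.
  have [[//|k] _ [z [yz _]]] := sigma_trans (open_cyl y n.+1)
    openT (cyl_neq0 y _) (ex_intro _ y I).
  exists (iter k sigma z) => j jn.
  have yzj : val y (j - 1) = val (iter k.+1 sigma z) (j - 1).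
    by apply: yz; lia.
  rewrite [LHS]yzj !val_iter_sigma; congr (val z _); lia.
exists (exist _ x (mem_set Xx)); apply/val_inj/funext => j.
by rewrite /= /Defs.shift /x addrK.
Qed.

Lemma iter_sigma_surj k y : exists x, iter k sigma x = y.
Proof.
elim: k y => [|k IH] y; first by exists y.
by have [z <-] := sigma_surj y; have [x <-] := IH z; exists x.
Qed.

(** Transitivity only gives a positive time; aiming at an [m]-fold preimage of [v] and then shifting
    [m] more times makes it at least [m]. *)
Lemma cyl_transitive m u N v p : exists2 a, (m <= a)%N &
  exists x, cyl u N x /\ cyl v p (iter a sigma x).
Proof.
have [w wv] := iter_sigma_surj m v.
have [n n0 [x [/= wx ux]]] := sigma_trans (open_cyl w (p + m)%N)
  (open_cyl u N) (cyl_neq0 w _) (cyl_neq0 u _).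
exists (m + n)%N; first exact: leq_addr.
exists x; split=> //; rewrite /cyl/= iterD -wv !(val_iter_sigma m).
exact: agree_shift.
Qed.

Variable T : X -> X.
Hypothesis cT : continuous T.
Hypothesis Tsigma : sigma \o T =1 T \o sigma.

Lemma iter_CA_sigma k a x :
  iter k T (iter a sigma x) = iter a sigma (iter k T x).
Proof.
elim: k => //= k ->; elim: a => //= a <-.
exact: esym (Tsigma _).
Qed.

(** Commutation with [sigma] transports the rule from coordinate 0: forward shifts reach [j >= 0],
    preimages under [sigma] reach [j < 0]. *)
Lemma local_rule : exists r : nat, forall x y (j : int),
  (forall i : int, (`|i - j| <= r)%N -> val x i = val y i) ->
  val (T x) j = val (T y) j.
Proof.
have [r rP] := local_rule0 cT; exists r => x y j xy.
pose a := `|j|%N.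
have [x' x'P] := iter_sigma_surj a x; have [y' y'P] := iter_sigma_surj a y.
have Ts z i : val (T (iter a sigma z)) i = val (T z) (i + a%:Z).
  by have /= -> := iter_CA_sigma 1 a z; rewrite val_iter_sigma.
have [j0|j0] : j = a%:Z \/ j = - a%:Z by lia.
  have xTa z : val (T z) j = val (T (iter a sigma z)) 0.
    by rewrite Ts add0r j0.
  rewrite !xTa; apply: rP => i ir; rewrite !val_iter_sigma; apply: xy; lia.
rewrite -x'P -y'P !Ts j0 addNr; apply: rP => i ir.
have := xy (i - a%:Z); rewrite -x'P -y'P !val_iter_sigma subrK; apply; lia.
Qed.

(** Equicontinuity at the single precision [2 ^- m]. *)
Definition stable_at (m : nat) : set X := [set x | exists n, forall y,
  agree n (val x) (val y) ->
  forall k, agree m (val (iter k T x)) (val (iter k T y))].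

Lemma EQ_bigcap : EQ T = \bigcap_m stable_at m.
Proof.
apply/seteqP; split=> [x xE m _|x xs e e0].
  have e0 : 0 < 2 ^- m :> R by rewrite invr_gt0 exprn_gt0.
  have [d d0 dP] := xE _ e0; have [n nd] := expr2V_small d0.
  exists n => y /sub_mdist_agree xy k; apply/sub_mdist_agree/dP.
  by rewrite ballEmdist/=; exact: lt_trans nd.
have [m me] := expr2V_small e0; have [n nP] := xs m I.
exists (2 ^- n); first by rewrite invr_gt0 exprn_gt0.
move=> y; rewrite ballEmdist/= => /sub_mdist_agree xy k.
by apply: lt_trans me; apply/sub_mdist_agree; exact: nP.
Qed.

Lemma open_stable_at m : open (stable_at m).
Proof.
rewrite openE => x [n nP]; apply/nbhs_agreeP; exists n => y xy.
exists n => z yz k; apply: agree_trans (agree_sym (nP y xy k)) _.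
by apply: nP; exact: agree_trans yz.
Qed.

Lemma not_sensitive_cyl m : ~ sensitive T -> exists u N, forall x y,
  cyl u N x -> cyl u N y ->
  forall k, (0 < k)%N -> agree m (val (iter k T x)) (val (iter k T y)).
Proof.
move=> ns; apply: contrapT => /forallNP nu; apply: ns.
(* Negating the strict inequality gives only [<=]; the extra factor 1/2 restores [< 2 ^- m]. *)
exists (2 ^- m.+1); first by rewrite invr_gt0 exprn_gt0.
move=> U oU [u Uu]; have [N uU] := open_cylP oU Uu.
have := nu u => /forallNP/(_ N)/existsNP[x] /existsNP[y].
move=> /not_implyP[ux] /not_implyP[uy] /existsNP[k] /not_implyP[k0] nxy.
exists x, y, k; split; [exact: uU|exact: uU|exact: k0|].
rewrite ltNge; apply/negP => xy; apply: nxy; apply/sub_mdist_agree.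
apply: le_lt_trans xy _.
by rewrite ltf_pV2 ?posrE ?exprn_gt0// ltr_eXn2l ?ltr1n.
Qed.

Lemma dense_stable_at m : ~ sensitive T -> dense (stable_at m).
Proof.
move=> ns V [v Vv] oV; have [p vV] := open_cylP oV Vv.
have [r rP] := local_rule.
have [u [N uP]] := not_sensitive_cyl r ns.
have [a ma [w' [uw' vw]]] := cyl_transitive m u N v p.
set w := iter a sigma w' in vw.
(* Radius [p + N + a] covers both the block of [v] at 0 and that of [u] at [-a], so [x] shows [u],
   [v], [u] around [-a], 0, [b]. *)
have [b mb [x [wx ux]]] := cyl_transitive m w (p + N + a) u N.
have left_block y : cyl w (p + N + a) y ->
    exists2 y', cyl u N y' & iter a sigma y' = y.
  move=> wy; have [y' y'y] := iter_sigma_surj a y; exists y' => //.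
  apply: agree_trans uw' _ => j jN; have := wy (j - a%:Z).
  rewrite /w -y'y !val_iter_sigma subrK; apply; lia.
exists x; split.
  by apply: vV; apply: agree_trans vw _; apply: agree_leq wx; lia.
exists (p + N + a + b + r)%N => y xy k.
have [x' ux' x'x] := left_block x wx.
have [y' uy' y'y] : exists2 y', cyl u N y' & iter a sigma y' = y.
  by apply: left_block; apply: agree_trans wx _; apply: agree_leq xy; lia.
have uy : cyl u N (iter b sigma y).
  apply: agree_trans ux _; rewrite !val_iter_sigma; apply: agree_shift.
  by apply: agree_leq xy; lia.
(* The induction carries the whole interval between the blocks, including [r] coordinates beyond
   [-a] and [b]; it contains [[-m, m]] as [a] and [b] are at least [m]. *)
suff xyk j : - (a + r)%:Z <= j <= (b + r)%:Z ->
    val (iter k T x) j = val (iter k T y) j.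
  by move=> j jm; apply: xyk; lia.
elim: k j => [|k IH] j jab; first by apply: xy; lia.
(* Within [r] of [-a] or [b], agreement at the positive time [k.+1] comes from the choice of [u],
   without the local rule. *)
have [ja|ja] := leqP `|j + a%:Z| r.
  have := uP _ _ ux' uy' k.+1 isT _ ja.
  by rewrite -x'x -y'y !iter_CA_sigma !val_iter_sigma.
have [jb|jb] := leqP `|j - b%:Z| r.
  have := uP _ _ ux uy k.+1 isT _ jb.
  by rewrite !iter_CA_sigma !val_iter_sigma subrK.
(* What remains is [-a + r < j < b - r], where the [r]-neighbourhood of [j] stays in the
   interval. *)
by apply: rP => i ij; apply: IH; lia.
Qed.

End Transitive.
End Subshift.

(** * Equicontinuity against sensitivity *)

Lemma equicontinuity_point_not_sensitive (R : realType) (M : metricType R)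
  (T : M -> M) x : equicontinuity_point T x -> ~ sensitive T.
Proof.
move=> xE [e e0 sT]; have e20 : 0 < e / 2 by rewrite divr_gt0.
have [d d0 dP] := xE _ e20.
(* Both orbits stay within [e / 2] of that of [x], hence within [e] of each other; the interior
   supplies the open set. *)
have [|y [z [n [/= xy xz _]]]] := sT (ball x d)° (open_interior _).
  by exists x; apply: nbhsx_ballx.
have xn w : (ball x d)° w -> ball (iter n T x) (e / 2) (iter n T w).
  by move=> /interior_subset xw; rewrite ballEmdist; exact: dP.
have := ball_splitr (xn _ xy) (xn _ xz).
by rewrite ballEmdist /= => /ltW; rewrite leNgt => /negP.
Qed.

Theorem proposition2p8 (R : realType) (A : finType) (hA : (1 < #|A|)%N)
    (X : subshift R A) (hX : (X : set (full_shift R A)) !=set0)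
    (hsigma : transitive_map (subshift_map X))
    (T : X -> X) (hT : cellular_automaton T) :
  almost_equicontinuous T <-> ~ sensitive T.
Proof.
have [cT Tsigma] := hT; split=> [[F oF EQF]|ns].
  have X0 : [set: X] !=set0.
    by have [x Xx] := hX; exists (exist _ x (mem_set Xx)).
  have [x] := subshift_baire X0 oF; rewrite -EQF.
  exact: equicontinuity_point_not_sensitive.
exists (stable_at T); last exact: EQ_bigcap.
by move=> m; split; [exact: open_stable_at|exact: dense_stable_at].
Qed.
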